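(* The late work minimization problem $P|d_j=d,n_i\leq N|Y$ and the resource leveling problem $P|p_j=1|\tilde{Y}$ are equivalent.
   Context: Late work minimization problem $P|d_j=d,n_i\leq N|Y$: an instance consists of a number $m$ of identical parallel machines, a set $\mathcal{J}$ of $n$ jobs with positive integer processing times $p_j$, a common due date $d$, and a machine capacity $N$ (a positive integer with $m\cdot N\geq n$). A schedule $S$ assigns each job $j$ a machine $\mu_j(S)\in\{1,\dots,m\}$ and a start time $t_j(S)\geq 0$ such that jobs on the same machine do not overlap, there is no idle time between jobs on any machine, and each machine receives at most $N$ jobs. With $J_i(S)=\{j:\mu_j(S)=i\}$, the late work is $Y(S)=\sum_{i=1}^m\max\{0,\sum_{j\in J_i(S)}p_j-d\}$, to be minimized. Resource leveling problem $P|p_j=1|\tilde{Y}$: an instance consists of $n$ jobs with unit processing times, $m$ identical parallel machines, a common deadline $C$ (with $m\cdot C\geq n$), a renewable resource with $L$ units available at any time, and an integer resource requirement $a_j\geq 0$ for each job; all data are integral. A schedule $S$ assigns each job a machine $\mu_j(S)\in\{1,\dots,m\}$ and a start time $t_j(S)\in\{0,\dots,C-1\}$ so that jobs on the same machine do not overlap, with the convention that if $k<m$ jobs start at time $t$, they occupy the first $k$ machines. With $J_t(S)=\{j:t_j(S)=t\}$, the objective to be minimized is $\tilde{Y}(S)=\sum_{t=0}^{C-1}\max\{0,\sum_{j\in J_t(S)}a_j-L\}$. Two optimization problems $\Pi_1,\Pi_2$ are called equivalent if there is a bijection $f$ from the instances of $\Pi_1$ to the instances of $\Pi_2$ and, for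 each instance $I$ of $\Pi_1$, a bijection $g$ from the set of feasible solutions of $I$ to the set of feasible solutions of $f(I)$ such that every solution $S$ of $I$ has the same objective value as $g(S)$ in $f(I)$.
   Formalization: Resource requirements are taken positive (a_j > 0 instead of a_j ≥ 0): with zero requirements allowed but p_j > 0 the equivalence fails, e.g. for n=4, m=3, C=2, L=1, a=(0,1,1,1), whose 72 schedules have values 2 (12 times) and 1 (60 times), matched by no late work instance. *)

(* Defs.v *)
From mathcomp Require Import all_boot.

Set Implicit Arguments.
Unset Strict Implicit.
Unset Printing Implicit Defensive.

(* All data are nonnegative integers, of type nat; truncated subtraction on   *)
(* nat is max{0, x - y}.  Sets {1, ..., m} of machines are encoded by 'I_m,   *)
(* numbered from 0.                                                           *)

Record min_problem := MinProblem {
  instance : Type;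
  solution : instance -> Type;
  objective : forall I : instance, solution I -> nat
}.

Arguments solution : clear implicits.
Arguments objective : clear implicits.

Definition equivalent (P1 P2 : min_problem) : Prop :=
  exists2 f : instance P1 -> instance P2, bijective f &
    forall I : instance P1,
      exists2 g : solution P1 I -> solution P2 (f I), bijective g &
        forall S : solution P1 I, objective P2 (f I) (g S) = objective P1 I S.

Definition restrict (P : min_problem) (A : pred (instance P)) : min_problem :=
  @MinProblem {I : instance P | A I}
    (fun I => solution P (val I)) (fun I => objective P (val I)).

Arguments restrict : clear implicits.

Record lw_instance := LwInstance {
  lw_machines : nat;
  lw_jobs : nat;
  lw_proc : {ffun 'I_lw_jobs -> nat};
  lw_due : nat;
  lw_cap : nat;
  lw_machines_gt0 : 0 < lw_machines;
  lw_cap_gt0 : 0 < lw_cap;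
  lw_cap_suff : lw_jobs <= lw_machines * lw_cap;
  lw_proc_gt0 : [forall j, 0 < lw_proc j]
}.

Record lw_schedule (I : lw_instance) := LwSchedule {
  lw_mach : {ffun 'I_(lw_jobs I) -> 'I_(lw_machines I)};
  lw_start : {ffun 'I_(lw_jobs I) -> nat}
}.

Section LateWork.

Variables (I : lw_instance) (S : lw_schedule I).

Definition lw_on (i : 'I_(lw_machines I)) : {set 'I_(lw_jobs I)} :=
  [set j | lw_mach S j == i].

Definition lw_end (j : 'I_(lw_jobs I)) : nat := lw_start S j + lw_proc I j.

Definition lw_nonoverlap : bool :=
  [forall j, forall k, (j != k) && (lw_mach S j == lw_mach S k) ==>
     (lw_end j <= lw_start S k) || (lw_end k <= lw_start S j)].

(* Machines are available from time 0 on, and idle time before the first job  *)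
(* is excluded too: every job starts either at time 0 or at the completion    *)
(* time of a job on the same machine.  In particular, as the processing times *)
(* are integers, so are all start times.                                      *)
Definition lw_no_idle : bool :=
  [forall j, (lw_start S j == 0) ||
     [exists k, (lw_mach S k == lw_mach S j) && (lw_end k == lw_start S j)]].

Definition lw_capacity : bool := [forall i, #|lw_on i| <= lw_cap I].

Definition lw_feasible : bool :=
  [&& lw_nonoverlap, lw_no_idle & lw_capacity].

Definition late_work_cost : nat :=
  \sum_(i < lw_machines I) (\sum_(j in lw_on i) lw_proc I j - lw_due I).

End LateWork.

Definition late_work : min_problem :=
  @MinProblem lw_instance
    (fun I => {S : lw_schedule I | lw_feasible S})
    (fun I S => late_work_cost (val S)).

Record rl_instance := RlInstance {
  rl_jobs : nat;
  rl_machines : nat;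
  rl_deadline : nat;
  rl_limit : nat;
  rl_req : {ffun 'I_rl_jobs -> nat};
  rl_machines_gt0 : 0 < rl_machines;
  rl_deadline_gt0 : 0 < rl_deadline;
  rl_deadline_suff : rl_jobs <= rl_machines * rl_deadline
}.

Record rl_schedule (I : rl_instance) := RlSchedule {
  rl_mach : {ffun 'I_(rl_jobs I) -> 'I_(rl_machines I)};
  rl_start : {ffun 'I_(rl_jobs I) -> 'I_(rl_deadline I)}
}.

Section ResourceLeveling.

Variables (I : rl_instance) (S : rl_schedule I).

Definition rl_at (t : 'I_(rl_deadline I)) : {set 'I_(rl_jobs I)} :=
  [set j | rl_start S j == t].

(* Jobs have unit length and integral start times, so two of them overlap iff *)
(* they start at the same time.                                               *)
Definition rl_nonoverlap : bool :=
  [forall j, forall k, (j != k) && (rl_mach S j == rl_mach S k) ==>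
     (rl_start S j != rl_start S k)].

Definition rl_first_machines : bool :=
  [forall t, (#|rl_at t| < rl_machines I) ==>
     ([set rl_mach S j | j in rl_at t] ==
      [set i : 'I_(rl_machines I) | i < #|rl_at t|])].

Definition rl_feasible : bool := rl_nonoverlap && rl_first_machines.

Definition resource_leveling_cost : nat :=
  \sum_(t < rl_deadline I) (\sum_(j in rl_at t) rl_req I j - rl_limit I).

End ResourceLeveling.

Definition resource_leveling : min_problem :=
  @MinProblem rl_instance
    (fun I => {S : rl_schedule I | rl_feasible S})
    (fun I S => resource_leveling_cost (val S)).

(* Processing times are positive, so requirements must be as well: with       *)
(* requirements 0, 1, 1, 1, limit 1, deadline 2 and 3 machines, the 72        *)
(* schedules have value 2 (12 times) or 1 (60 times), a distribution that no  *)
(* late work instance has.                                                    *)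
Definition positive_requirements : pred (instance resource_leveling) :=
  fun I : rl_instance => [forall j, 0 < rl_req I j].

(* Main.v *)
(* Late work machines play the role of time slots, and the position of a job  *)
(* in the processing order of its machine plays the role of its machine in    *)
(* the resource leveling problem.  Positions and start times determine each   *)
(* other: both are strictly monotone functions (cardinality and total         *)
(* processing time) of the set of jobs that precede a given job on its        *)
(* machine.                                                                   *)
Require Import Defs.
From mathcomp Require Import all_boot.

Set Implicit Arguments.
Unset Strict Implicit.
Unset Printing Implicit Defensive.

(** Instances correspond by renaming: machines become time slots, capacity becomes the number of
    machines, due date the limit, processing times the requirements. Machine i and slot i carry the
    same jobs, so costs agree, and only the order inside a slot has to be translated. Going over, a
    start time is replaced by [rank], the number of predecessors; going back, a position is replaced
    by [start], their total processing time. Both maps keep the predecessor sets ([before_rank],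
    [before_start]). Each schedule is determined by these sets: absence of overlap and idle time
    forces start times ([start_id]), and the first-machines convention forces positions ([rank_id]).
    Hence the two maps are mutually inverse. *)

Section Predecessors.

Variables (T : finType) (M : eqType) (mach : T -> M).
Implicit Types (h : T -> nat) (j k : T).

Definition before h j : {set T} :=
  [set k | (mach k == mach j) && (h k < h j)].

Lemma before_subset h j k :
  mach j = mach k -> h j <= h k -> before h j \subset before h k.
Proof.
move=> mjk hjk; apply/subsetP => l; rewrite !inE mjk => /andP[-> /=].
by move=> /leq_trans; apply.
Qed.

Lemma before_proper h j k :
  mach j = mach k -> h j < h k -> before h j \proper before h k.
Proof.
move=> mjk hjk; apply/properP; split; first exact/before_subset/ltnW.
by exists j; rewrite !inE ?mjk ?eqxx ?hjk ?ltnn.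
Qed.

(** Predecessor sets on one machine form a chain under inclusion, strictly growing with [h]; a
    strictly monotone [F] therefore orders the jobs of a machine exactly as [h] does. *)
Lemma before_mono (F : {set T} -> nat) h :
    (forall A B : {set T}, A \proper B -> F A < F B) ->
  before (fun j => F (before h j)) =1 before h.
Proof.
move=> Fmono j; apply/setP => k; rewrite !inE.
have [mkj /=|//] := eqVneq (mach k) (mach j).
have [hkj|hjk] := ltnP (h k) (h j); first exact/Fmono/before_proper.
apply/negbTE; rewrite -leqNgt.
have := before_subset (esym mkj) hjk.
by rewrite subEproper => /predU1P[->//|/Fmono/ltnW].
Qed.

Definition rank h j := #|before h j|.

Lemma before_rank h : before (rank h) =1 before h.
Proof. exact/(before_mono (F := fun A => #|A|))/proper_card. Qed.

Lemma rank_lt_card h j : rank h j < #|[set k | mach k == mach j]|.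
Proof.
apply/proper_card/properP; split.
  by apply/subsetP => k; rewrite !inE => /andP[].
by exists j; rewrite !inE ?eqxx ?ltnn.
Qed.

Lemma rank_inj h j k : mach j = mach k -> h j != h k -> rank h j != rank h k.
Proof.
move=> mjk; rewrite !neq_ltn => /orP[] hjk; apply/orP; [left|right];
  exact/proper_card/before_proper.
Qed.

(** The predecessors of [j] take each of the values 0, ..., [h j] - 1 exactly once, so there are
    [h j] of them. *)
Lemma rank_id h :
    (forall j k, mach j = mach k -> h j = h k -> j = k) ->
    (forall j i, i < h j -> exists2 k, mach k = mach j & h k = i) ->
  rank h =1 h.
Proof.
move=> hinj hdown j; rewrite /rank cardE -(size_map h) -[RHS](size_iota 0).
apply/perm_size/uniq_perm; last 1 first.
- move=> i; rewrite mem_iota add0n /=; apply/mapP/idP => [[k]|].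
    by rewrite mem_enum inE => /andP[_ hkj ->].
  move=> ij; have [k mkj hk] := hdown _ _ ij.
  by exists k => //; rewrite mem_enum inE mkj hk eqxx.
- rewrite map_inj_in_uniq ?enum_uniq // => k l.
  rewrite !mem_enum !inE => /andP[/eqP mk _] /andP[/eqP ml _].
  by apply: hinj; rewrite mk.
- exact: iota_uniq.
Qed.

Variable p : T -> nat.
Hypothesis p_gt0 : forall j, 0 < p j.

Definition start h j := \sum_(k in before h j) p k.

Lemma before_start h : before (start h) =1 before h.
Proof.
apply: (before_mono (F := fun A => \sum_(k in A) p k)) => A B.
case/properP=> sAB [x xB xA]; rewrite [ltnRHS](big_setID A) /=.
(* The sum grows strictly because the extra element [x] has positive processing time. *)
rewrite (setIidPr sAB) -[ltnLHS]addn0 ltn_add2l (bigD1 x) ?inE ?xA //=.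
exact: ltn_addr.
Qed.

(** Here [j] is the immediate predecessor of [k], so the predecessors of [k] are those of [j]
    together with [j]. *)
Lemma start_after h j k :
    mach j = mach k -> h j < h k ->
    (forall l, mach l = mach k -> h l < h k -> l = j \/ h l < h j) ->
  start h k = start h j + p j.
Proof.
move=> mjk hjk between; rewrite /start (bigD1 j) ?inE ?mjk ?eqxx //= addnC.
congr (_ + _); apply: eq_bigl => l; rewrite !inE mjk -andbA.
have [mlk /=|//] := eqVneq (mach l) (mach k).
have [->|lj] := eqVneq l j; first by rewrite ltnn andbF.
rewrite andbT; apply/idP/idP => [/(between _ mlk)[ljE|//]|hlj].
  by rewrite ljE eqxx in lj.
exact: ltn_trans hjk.
Qed.

Lemma start_separated h j k :
  mach j = mach k -> h j < h k -> start h j + p j <= start h k.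
Proof.
move=> mjk hjk; rewrite /start.
rewrite [leqRHS](bigD1 j) ?inE ?mjk ?eqxx //= addnC leq_add2l.
rewrite big_mkcond [leqRHS]big_mkcond /=; apply: leq_sum => l _.
rewrite !inE mjk -andbA; case: (mach l == mach k) => //=.
have [hlj|//] := ltnP (h l) (h j).
have -> : l != j by apply: contraTneq hlj => ->; rewrite ltnn.
by rewrite (ltn_trans hlj).
Qed.

(** Strong induction on the start time: a job that ends exactly when [j] starts is its immediate
    predecessor, so [start_after] applies. *)
Lemma start_id s :
    (forall j k, j != k -> mach j = mach k ->
       (s j + p j <= s k) || (s k + p k <= s j)) ->
    (forall j, s j = 0 \/ exists2 k, mach k = mach j & s k + p k = s j) ->
  start s =1 s.
Proof.
move=> nonoverlap no_idle j.
have [n] := ubnP (s j); elim: n j => // n IHn j sjn.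
have [sj0|[k mkj skj]] := no_idle j.
  by rewrite /start big1 ?sj0 // => k; rewrite inE sj0 ltn0 andbF.
have ltkj : s k < s j by rewrite -skj -[ltnLHS]addn0 ltn_add2l.
rewrite (start_after mkj ltkj) ?IHn //; first exact: leq_trans ltkj _.
move=> l mlj ltlj; have [->|lk] := eqVneq l k; [by left | right].
(* Since [k] ends at [s j], after [l] starts, [l] must end before [k] starts. *)
have /orP[] := nonoverlap _ _ lk (etrans mlj (esym mkj)).
  by apply: leq_trans; rewrite -[ltnLHS]addn0 ltn_add2l.
by rewrite skj leqNgt ltlj.
Qed.

End Predecessors.

(** * Bijection between instances *)

Definition rl_of_lw (I : lw_instance) : rl_instance :=
  RlInstance (lw_due I) (lw_proc I) (lw_cap_gt0 I) (lw_machines_gt0 I)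
    (leq_trans (lw_cap_suff I) (eq_leq (mulnC _ _))).

Definition instance_map (I : instance late_work) :
    instance (restrict resource_leveling positive_requirements) :=
  exist _ (rl_of_lw I) (lw_proc_gt0 I).

Definition instance_inv
    (I : instance (restrict resource_leveling positive_requirements)) :
    instance late_work :=
  LwInstance (rl_limit (val I)) (rl_deadline_gt0 (val I))
    (rl_machines_gt0 (val I))
    (leq_trans (rl_deadline_suff (val I)) (eq_leq (mulnC _ _))) (valP I).

Lemma instance_mapK : cancel instance_map instance_inv.
Proof.
case=> m n p d N m_gt0 N_gt0 suff p_gt0 /=; rewrite /rl_of_lw /=.
(* The data return unchanged; proofs of boolean conditions are unique. *)
by congr LwInstance; apply: bool_irrelevance.
Qed.

Lemma instance_invK : cancel instance_inv instance_map.
Proof.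
case=> -[n m C L a m_gt0 C_gt0 suff] a_gt0; apply: val_inj.
by rewrite /= /rl_of_lw /=; congr RlInstance; apply: bool_irrelevance.
Qed.

Section Schedules.

Variable I : lw_instance.

Let p_gt0 j : 0 < lw_proc I j := forallP (lw_proc_gt0 I) j.

(** * From start times to positions *)

Section LwToRl.

Variable S : lw_schedule I.
Hypothesis feasS : lw_feasible S.

Lemma lw_separated j k :
    j != k -> lw_mach S j = lw_mach S k ->
  (lw_start S j + lw_proc I j <= lw_start S k) ||
  (lw_start S k + lw_proc I k <= lw_start S j).
Proof.
case/and3P: feasS => /forallP/(_ j)/forallP/(_ k) + _ _ jk mjk.
by rewrite jk mjk eqxx.
Qed.

Lemma lw_start_inj j k :
  j != k -> lw_mach S j = lw_mach S k -> lw_start S j != lw_start S k.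
Proof.
move=> jk /(lw_separated jk); apply: contraTneq => ->.
by rewrite -!subn_eq0 !addKn negb_or -!lt0n !p_gt0.
Qed.

Lemma lw_start_id : start (lw_mach S) (lw_proc I) (lw_start S) =1 lw_start S.
Proof.
apply: start_id => // [|j]; first exact: lw_separated.
case/and3P: feasS => _ /forallP/(_ j)/orP[/eqP|/existsP[k]]; first by left.
by case/andP=> /eqP mkj /eqP skj; right; exists k.
Qed.

Lemma lw_rank_bound j : rank (lw_mach S) (lw_start S) j < lw_cap I.
Proof.
apply: leq_trans (rank_lt_card _ _ _) _.
by case/and3P: feasS => _ _ /forallP; apply.
Qed.

Definition rl_sched : rl_schedule (rl_of_lw I) :=
  @RlSchedule (rl_of_lw I) [ffun j => Ordinal (lw_rank_bound j)] (lw_mach S).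

Lemma rl_sched_feasible : rl_feasible rl_sched.
Proof.
have rinj j k : lw_mach S j = lw_mach S k ->
    rl_mach rl_sched j = rl_mach rl_sched k -> j = k.
  move=> mjk /(congr1 val); rewrite !ffunE /=; apply: contra_eq => jk.
  exact/rank_inj/lw_start_inj.
apply/andP; split.
  apply/'forall_forallP => j k; apply/implyP => /andP[jk /eqP rjk].
  by apply: contra_neq jk => mjk; apply: rinj.
(* The ranks in a slot are distinct and smaller than its number of jobs, so by counting they fill an
   initial segment. *)
apply/forallP => t; apply/implyP => ltM; rewrite eqEcard; apply/andP; split.
  apply/subsetP => _ /imsetP[j + ->]; rewrite !inE ffunE /= => /eqP <-.
  exact: rank_lt_card.
rewrite card_in_imset => [|j k]; last first.
  by rewrite !inE => /eqP mj /eqP mk; apply: rinj; rewrite mj mk.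
rewrite cardE -(size_map val) -[leqRHS](size_iota 0).
apply: uniq_leq_size => [|i]; first by rewrite (map_inj_uniq val_inj) enum_uniq.
by case/mapP => x; rewrite mem_enum inE mem_iota => ? ->.
Qed.

End LwToRl.

(** * From positions to start times *)

Section RlToLw.

Variable S : rl_schedule (rl_of_lw I).
Hypothesis feasS : rl_feasible S.

Let pos (j : 'I_(lw_jobs I)) : nat := rl_mach S j.
Let slot : 'I_(lw_jobs I) -> 'I_(lw_machines I) := rl_start S.

Lemma rl_pos_inj j k : slot j = slot k -> pos j = pos k -> j = k.
Proof.
case/andP: feasS => /'forall_forallP/(_ j k)/implyP jkP _ sjk /val_inj rjk.
by apply: contra_eq sjk => jk; apply: jkP; rewrite jk rjk eqxx.
Qed.

Lemma rl_mach_inj t : {in rl_at S t &, injective (rl_mach S)}.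
Proof.
move=> j k; rewrite !inE => /eqP sj /eqP sk rjk.
by apply: rl_pos_inj; rewrite /slot /pos ?sj ?sk ?rjk.
Qed.

Lemma rl_at_bound t : #|rl_at S t| <= lw_cap I.
Proof.
by rewrite -(card_in_imset (@rl_mach_inj t)) -[leqRHS]card_ord max_card.
Qed.

(** In a slot that is not full, the convention makes the used machines an initial segment; in a full
    slot, injectivity makes every machine used. *)
Lemma rl_pos_down j i : i < pos j -> exists2 k, slot k = slot j & pos k = i.
Proof.
move=> ij; have iN : i < lw_cap I by apply: ltn_trans ij (ltn_ord _).
suff: Ordinal iN \in [set rl_mach S k | k in rl_at S (slot j)].
  by case/imsetP=> k; rewrite inE => /eqP skj rk; exists k; rewrite // /pos -rk.
have jat : j \in rl_at S (slot j) by rewrite inE.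
case/andP: feasS => _ /forallP/(_ (slot j)).
have [lt /eqP eqim|ge _] := ltnP #|rl_at S (slot j)| (lw_cap I).
  have := imset_f (rl_mach S) jat; rewrite eqim !inE /=.
  exact: ltn_trans.
suff /eqP-> : [set rl_mach S k | k in rl_at S (slot j)] == setT by rewrite inE.
by rewrite eqEcard subsetT card_in_imset ?cardsT ?card_ord //; apply: rl_mach_inj.
Qed.

Definition lw_sched : lw_schedule I :=
  LwSchedule (rl_start S) [ffun j => start slot (lw_proc I) pos j].

Lemma lw_sched_feasible : lw_feasible lw_sched.
Proof.
apply/and3P; split; last exact/forallP/rl_at_bound.
  apply/'forall_forallP => j k; apply/implyP => /andP[jk /eqP sjk].
  have : pos j != pos k by apply: contra_neq jk; apply: rl_pos_inj.
  rewrite /lw_end !ffunE neq_ltn.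
  case/orP=> [/(start_separated (lw_proc I) sjk) -> //|].
  by move/(start_separated (lw_proc I) (esym sjk)) ->; rewrite orbT.
apply/forallP => j; rewrite ffunE.
have [pj0|pj_gt0] := posnP (pos j).
  by rewrite /start big1 // => k; rewrite inE pj0 ltn0 andbF.
(* The job one position lower in the slot ends exactly when [j] starts. *)
have [k skj pk] : exists2 k, slot k = slot j & pos k = (pos j).-1.
  by apply: rl_pos_down; rewrite prednK.
apply/orP; right; apply/existsP; exists k; rewrite /lw_end ffunE /=.
apply/andP; split; first exact/eqP.
apply/eqP/esym/start_after; rewrite ?pk ?prednK // => l slj.
rewrite -[in pos l < pos j](prednK pj_gt0) ltnS -pk leq_eqVlt.
case/predU1P=> [plk|]; [left | by right].
by apply: rl_pos_inj; rewrite // slj.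
Qed.

End RlToLw.

(** * Bijection between solutions *)

Definition solution_map (S : solution late_work I) :
    solution resource_leveling (rl_of_lw I) :=
  exist _ (rl_sched (valP S)) (rl_sched_feasible (valP S)).

Definition solution_inv (S : solution resource_leveling (rl_of_lw I)) :
    solution late_work I :=
  exist _ (lw_sched (val S)) (lw_sched_feasible (valP S)).

Lemma solution_mapK : cancel solution_map solution_inv.
Proof.
move=> S; apply: val_inj; case: S => -[mch st] feas /=.
congr LwSchedule; apply/ffunP => j; rewrite ffunE -[RHS](lw_start_id feas).
rewrite /start; apply: eq_bigl => k; congr (k \in pred_of_set _) => /=.
(* Ranks and start times have the same predecessor sets, hence yield the same sums. *)
by rewrite -[RHS]before_rank; apply/setP => l; rewrite !inE !ffunE.
Qed.

Lemma solution_invK : cancel solution_inv solution_map.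
Proof.
move=> S; apply: val_inj; case: S => -[mch st] feas /=.
congr RlSchedule; apply/ffunP => j; rewrite ffunE; apply: val_inj => /=.
have /(_ j)/= <- := rank_id (rl_pos_inj feas) (rl_pos_down feas).
rewrite /rank -[in RHS](before_start _ p_gt0); congr #|pred_of_set _|.
by apply/setP => l; rewrite !inE !ffunE.
Qed.

End Schedules.

Theorem theorem1 :
  equivalent late_work (restrict resource_leveling positive_requirements).
Proof.
exists instance_map; first exact: Bijective instance_mapK instance_invK.
(* Equality of the values holds by computation, as the jobs of each machine become those of the slot
   with the same index. *)
move=> I; exists (@solution_map I) => //.
exact: Bijective (@solution_mapK I) (@solution_invK I).
Qed.
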